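(* Let $\mu$ be a non-atomic (shift-invariant) Markov measure on $X^{\mathbb N}$ and let $g:X^{\mathbb N}\to X^{\mathbb N}$ be a tree endomorphism of subexponential activity growth. Then the measure $g_*\mu$ is absolutely continuous with respect to $\mu$ if and only if for all $w\in V_{\max}(g)$ and $x\in X$, $\mu(wxX^{\mathbb N})=0$ implies $\mu(g^{-1}(wxX^{\mathbb N}))=0$. If this is the case, then the Radon-Nikodym derivative is given by $$\frac{dg_*\mu}{d\mu}=\sum_{\substack{w\in V_{\max}(g),\ x\in X:\\ \mu(wxX^{\mathbb N})\neq 0}}\frac{\mu(g^{-1}(wxX^{\mathbb N}))}{\mu(wxX^{\mathbb N})}\,\chi_{wxX^{\mathbb N}},$$ where $\chi_E$ denotes the characteristic function of a set $E$.
   Context: $X$ is a finite set (alphabet) with more than one element, $X^*$ is the set of all finite words over $X$ (including the empty word), $X^{\mathbb N}$ is the set of infinite sequences over $X$ with the product topology. For $w\in X^*$ the cylinder $wX^{\mathbb N}$ is the set of sequences with prefix $w$. Pushforward: $g_*\mu(E)=\mu(g^{-1}(E))$ for Borel $E\subset X^{\mathbb N}$. Markov measure: given a stochastic matrix $L=(L_{xy})_{x,y\in X}$ and a stationary probability vector $\boldsymbol{l}$ of $L$ ($\boldsymbol{l}L=\boldsymbol{l}$), the Markov measure $\mu$ is the Borel probability measure with $\mu(x_1x_2\ldots x_nX^{\mathbb N})=\boldsymbol{l}_{x_1}L_{x_1x_2}\cdots L_{x_{n-1}x_n}$. (All Markov measures considered are shift-invariant, i.e. $\boldsymbol{l}$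 is stationary; $L$ need not be irreducible.) A Borel measure on $X^{\mathbb N}$ is non-atomic if every one-element set has measure zero. Tree endomorphism: a map $g:X^*\to X^*$ that preserves the length of every word and does not decrease the length of the longest common prefix of any two words. It induces a unique map $X^{\mathbb N}\to X^{\mathbb N}$ (also denoted $g$ and called a tree endomorphism) such that $g(u)$ is a prefix of $g(\omega)$ whenever $u$ is a prefix of $\omega$. For $u\in X^*$, the restriction $g|_u:X^*\to X^*$ is the unique map with $g(uw)=g(u)\,g|_u(w)$ for all $w\in X^*$; it is called trivial if it is the identity map. Activity growth: $R_g(n)$ is the number of words $w\in X^*$ of length $n$ with $g|_w$ nontrivial. $g$ has subexponential activity growth if for every $c>1$, $R_g(n)\le c^n$ for all sufficiently large $n$. $V(g)$ is the set of all $w\in X^*$ such that $g|_u$ is trivial for every $u\in X^*$ with $g(u)=w$ (including the case when no such $u$ exists). $V_{\max}(g)$ is the set of those $w\in V(g)$ such that no word in $V(g)$ is a proper prefix of $w$. *)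

(* Defs.v *)
From HB Require Import structures.
From mathcomp Require Import all_boot all_order all_algebra.
From mathcomp Require Import all_classical all_reals all_analysis.

Set Implicit Arguments.
Unset Strict Implicit.
Unset Printing Implicit Defensive.

Import Order.TTheory GRing.Theory Num.Theory.
Import numFieldNormedType.Exports.

Local Open Scope classical_set_scope.
Local Open Scope ring_scope.

(* The proof [hX] only serves to build the point that [measurableType]
   requires; no letter of the alphabet is distinguished. *)
Definition infseq (X : finType) (hX : (1 < #|X|)%N) : Type := nat -> X.

Section infseq.
Variables (X : finType) (hX : (1 < #|X|)%N).

Definition letter : X := enum_val (Ordinal (ltnW hX)).

HB.instance Definition _ := Topological.copy (infseq hX)
  (prod_topology (fun _ : nat => discrete_topology X)).
HB.instance Definition _ :=
  isPointed.Build (infseq hX) (fun _ : nat => letter).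
(* Borel sigma-algebra of the product topology *)
HB.instance Definition _ := Measurable.copy (infseq hX)
  (g_sigma_algebraType (@open (infseq hX))).

Definition cylinder (w : seq X) : set (infseq hX) :=
  [set om | mkseq om (size w) = w].

End infseq.

Arguments cylinder {X} hX w.

Section markov.
Variables (X : finType) (hX : (1 < #|X|)%N) (R : realType).

Definition stochastic (L : X -> X -> R) : Prop :=
  (forall x y, 0 <= L x y) /\ (forall x, \sum_y L x y = 1).

Definition prob_vector (l : X -> R) : Prop :=
  (forall x, 0 <= l x) /\ \sum_x l x = 1.

Definition stationary (L : X -> X -> R) (l : X -> R) : Prop :=
  forall y, \sum_x l x * L x y = l y.

Definition is_markov (mu : probability (infseq hX) R) : Prop :=
  exists (L : X -> X -> R) (l : X -> R),
    [/\ stochastic L, prob_vector l, stationary L l &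
      forall (x : X) (u : seq X), mu (cylinder hX (x :: u)) =
        (l x * \prod_(c <- pairmap L x u) c)%:E].

Definition non_atomic (mu : probability (infseq hX) R) : Prop :=
  forall om : infseq hX, mu [set om] = 0%E.

End markov.

Fixpoint lcp (X : eqType) (u v : seq X) : seq X :=
  match u, v with
  | x :: u', y :: v' => if x == y then x :: lcp u' v' else [::]
  | _, _ => [::]
  end.

Record treeEndo (X : finType) := TreeEndo {
  tree_fun :> seq X -> seq X ;
  tree_size : forall u, size (tree_fun u) = size u ;
  tree_lcp : forall u v,
    (size (lcp u v) <= size (lcp (tree_fun u) (tree_fun v)))%N }.

Section words.
Variable X : finType.
Implicit Types (g : treeEndo X) (u v w : seq X).

(* meaningful in view of [restrP] below *)
Definition restr g u : seq X -> seq X := fun w => drop (size u) (g (u ++ w)).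

Definition trivial_restr g u : Prop := forall w, restr g u w = w.

Definition activity g (n : nat) : nat :=
  #|[set t : n.-tuple X | ~~ `[< trivial_restr g t >]]|.

Definition subexponential_activity (R : realType) g : Prop :=
  forall c : R, 1 < c -> \forall n \near \oo, (activity g n)%:R <= c ^+ n.

Definition V g : set (seq X) :=
  [set w | forall u, g u = w -> trivial_restr g u].

Definition Vmax g : set (seq X) :=
  [set w | V g w /\ forall v, V g v -> ~ (prefix v w /\ v <> w)].

Lemma lcp_cat u w : lcp u (u ++ w) = u.
Proof. by elim: u => [|x u IH] /=; [case: w|rewrite eqxx IH]. Qed.

Lemma lcp_take u v : lcp u v = take (size (lcp u v)) v.
Proof.
by elim: u v => [|x u IH] [|y v] //=; case: eqP => [->|] //=; rewrite -IH.
Qed.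

Lemma lcp_takel u v : lcp u v = take (size (lcp u v)) u.
Proof.
by elim: u v => [|x u IH] [|y v] //=; case: eqP => [->|] //=; rewrite -IH.
Qed.

Lemma tree_take g u w : take (size u) (g (u ++ w)) = g u.
Proof.
have le_u : (size u <= size (lcp (g u) (g (u ++ w))))%N.
  by have := tree_lcp g u (u ++ w); rewrite lcp_cat.
have : size (lcp (g u) (g (u ++ w))) = size u.
  apply/eqP; rewrite eqn_leq le_u andbT lcp_takel size_take_min tree_size.
  exact: geq_minr.
move=> e; rewrite -[in LHS]e -lcp_take lcp_takel e.
by rewrite take_oversize ?tree_size.
Qed.

Lemma restrP g u w : g (u ++ w) = g u ++ restr g u w.
Proof. by rewrite -(cat_take_drop (size u) (g (u ++ w))) tree_take. Qed.

Lemma restr_unique g u (h : seq X -> seq X) :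
  (forall w, g (u ++ w) = g u ++ h w) -> h = restr g u.
Proof.
move=> gh; apply/funext => w.
by rewrite /restr gh -(tree_size g u) drop_size_cat.
Qed.

End words.

Section boundary.
Variables (X : finType) (hX : (1 < #|X|)%N) (g : treeEndo X).

(* The induced map on infinite sequences, characterized by [boundaryP] and
   [boundary_unique]; the default value [om n] is never reached. *)
Definition boundary (om : infseq hX) : infseq hX :=
  fun n => nth (om n) (g (mkseq om n.+1)) n.

Lemma boundaryP (om : infseq hX) n : mkseq (boundary om) n = g (mkseq om n).
Proof.
have e k : (k < n)%N -> boundary om k = nth (om 0) (g (mkseq om n)) k.
  move=> kn; rewrite /boundary (set_nth_default (om 0)); last first.
    by rewrite tree_size size_mkseq.
  have -> : mkseq om n = mkseq om k.+1 ++ drop k.+1 (mkseq om n).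
    rewrite -[LHS](cat_take_drop k.+1); congr (_ ++ _).
    by rewrite /mkseq -map_take take_iota (minn_idPl kn).
  by rewrite restrP nth_cat tree_size size_mkseq ltnSn.
apply: (@eq_from_nth _ (om 0)); first by rewrite tree_size !size_mkseq.
by rewrite size_mkseq => k kn; rewrite nth_mkseq// e.
Qed.

Lemma boundary_unique (h : infseq hX -> infseq hX) :
  (forall om n, mkseq (h om) n = g (mkseq om n)) -> h = boundary.
Proof.
move=> hg; apply/funext => om; apply/funext => n.
have : mkseq (h om) n.+1 = mkseq (boundary om) n.+1 by rewrite hg boundaryP.
by move=> /(congr1 (fun s => nth (om 0) s n)); rewrite !nth_mkseq.
Qed.

Lemma near_mkseq (om : infseq hX) n :
  \forall x \near om, mkseq x n = mkseq om n.
Proof.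
elim: n => [|n IH]; first by apply: filterE.
have pn : \forall x \near om, x n = om n.
  apply: (@proj_continuous nat (fun _ => discrete_topology X) n om
    [set om n]).
  exact: (@discrete_set1 (discrete_topology X)).
by apply: filterS2 IH pn => x xn e; rewrite !mkseqS xn e.
Qed.

Lemma boundary_continuous : continuous boundary.
Proof.
move=> om.
have FF : Filter (boundary x @[x --> om]).
  by apply: fmap_filter; exact: nbhs_filter.
apply/cvg_sup => i U [_ [[W] oW <-] Wom WU].
apply: (filterS WU); apply: filterS (near_mkseq om i.+1) => x xom /=.
suff -> : boundary x i = boundary om i by [].
suff : mkseq (boundary x) i.+1 = mkseq (boundary om) i.+1.
  by move=> /(congr1 (fun s => nth (om 0) s i)); rewrite !nth_mkseq.
by rewrite !boundaryP xom.
Qed.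

Lemma boundary_measurable : measurable_fun [set: infseq hX] boundary.
Proof.
apply: (measurability (@open (infseq hX))) => // _ [B oB <-].
rewrite setTI; apply: sub_sigma_algebra.
by move/continuousP: boundary_continuous; exact.
Qed.

HB.instance Definition _ :=
  isMeasurableFun.Build _ _ _ _ boundary boundary_measurable.

End boundary.

Section density.
Variables (X : finType) (hX : (1 < #|X|)%N) (R : realType).
Variables (mu : probability (infseq hX) R) (g : treeEndo X).
Local Open Scope ereal_scope.

Definition density (om : infseq hX) : \bar R :=
  \esum_(p in [set p : seq X * X |
                Vmax g p.1 /\ mu (cylinder hX (rcons p.1 p.2)) <> 0])
    (mu (boundary g @^-1` cylinder hX (rcons p.1 p.2))
       / mu (cylinder hX (rcons p.1 p.2))
       * (\1_(cylinder hX (rcons p.1 p.2)) om)%:E).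

End density.

(* Main.v *)
Require Import Defs.
From mathcomp Require Import all_boot all_order all_algebra.
From mathcomp Require Import all_classical all_reals all_analysis.
From mathcomp Require Import measurable_realfun lra.

(** Write [nu] for the image of [mu] under [g]. Two facts carry the theorem.

    Exponential decay against subexponential growth. In a Markov chain the
    only way for cylinders not to shrink geometrically is a state of positive
    mass from which the future is forced; the chain then has an atom. So for a
    non-atomic Markov measure the mass of a cylinder of depth [n] is at most
    [C * r ^ n] with [r < 1] ([cylinder_decay]), and a set that is covered, at
    every large depth [n], by at most [activity g n] cylinders is null
    ([null_of_few_cylinders]). This applies to the sequences along which the
    restriction of [g] never becomes trivial, because [activity g n] counts
    exactly the words of length [n] where it is not. It also applies to the
    preimage of the set [exceptional] of sequences without prefix in [V g].
    Indeed every word outside [V g] is the image of a word with nontrivial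
    restriction, so there are at most [activity g n] of them at depth [n], and
    below a word [u] with trivial restriction [g] only replaces the prefix
    [u], so it creates no additional cylinders. Hence [nu] gives no mass to
    [exceptional] ([exceptional_preimage_null]).

    Local proportionality. If [w] is in [V g], the preimage of the cylinder of
    [w ++ s] is the disjoint union of the cylinders of [u ++ s] over the
    finitely many [u] with [g u = w]. By the Markov property the part of
    [s = x :: v] after its first letter contributes the same factor to every
    term, and the same factor to the mass of the cylinder of [w ++ s] itself.
    Thus on the cylinder of [rcons w x] the measures [nu] and [mu] are
    proportional ([distribution_proportional]); fixing the letter [x] is
    needed because the weight of the transition from the last letter of [u]
    depends on [u].

    The cylinders of [rcons w x], for [w] in [Vmax g], are disjoint and cover
    everything outside [exceptional]. When those that are null for [mu] are
    null for [nu], summing the proportionality over them gives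
    [nu E = \int[mu]_(om in E) density mu g om] for every measurable [E]
    ([distribution_integral]), from which both absolute continuity and the
    formula for the derivative follow. The converse implication only tests
    absolute continuity on cylinders. *)

Set Implicit Arguments.
Unset Strict Implicit.
Unset Printing Implicit Defensive.

Import Order.TTheory GRing.Theory Num.Theory.
Import numFieldNormedType.Exports.

Local Open Scope classical_set_scope.
Local Open Scope ring_scope.
Local Open Scope ereal_scope.
Local Open Scope charge_scope.

(** * Cylinders and the Borel sigma-algebra *)
Section cylinders.
Variables (X : finType) (hX : (1 < #|X|)%N).
Implicit Types (om : infseq hX) (u v w : seq X).

Lemma mem_cylinder om n : cylinder hX (mkseq om n) om.
Proof. by rewrite /cylinder /= size_mkseq. Qed.

Lemma take_mkseq om m n : (m <= n)%N -> take m (mkseq om n) = mkseq om m.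
Proof. by move=> mn; rewrite /mkseq -map_take take_iota (minn_idPl mn). Qed.

Lemma cylinder_cat u v om : cylinder hX (u ++ v) om -> cylinder hX u om.
Proof.
move=> /= uv; rewrite /cylinder/= -(@take_mkseq om _ (size (u ++ v))).
  by rewrite uv take_size_cat.
by rewrite size_cat leq_addr.
Qed.

Lemma cylinder_eq u v om : cylinder hX u om -> cylinder hX v om ->
  size u = size v -> u = v.
Proof. by rewrite /cylinder/= => {2}<- {2}<- ->. Qed.

Lemma cylinder_prefix u v om : cylinder hX u om -> cylinder hX v om ->
  (size u <= size v)%N -> v = u ++ drop (size u) v.
Proof.
rewrite /cylinder/= => uom vom uv.
by rewrite -[LHS](cat_take_drop (size u)) -{1}vom take_mkseq// uom.
Qed.

Lemma cylinder_nil : cylinder hX [::] = setT.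
Proof. by apply/seteqP; split. Qed.

Lemma set1_bigcap_cylinder (om : infseq hX) :
  [set om] = \bigcap_n cylinder hX (mkseq om n).
Proof.
apply/seteqP; split=> [_ -> n _|x xom]; first exact: mem_cylinder.
apply/funext => n; have := xom n.+1 I; rewrite /cylinder/mkset size_mkseq.
by move=> /(congr1 (fun s => nth (om 0%N) s n)); rewrite !nth_mkseq.
Qed.

Lemma open_mkseq n (P : set (seq X)) :
  open [set om : infseq hX | P (mkseq om n)].
Proof.
rewrite openE => om /= Pom; rewrite /interior.
by apply: filterS (near_mkseq om n) => x /= ->.
Qed.

Lemma measurable_mkseq n (P : set (seq X)) :
  measurable [set om : infseq hX | P (mkseq om n)].
Proof. by apply: sub_sigma_algebra; exact: open_mkseq. Qed.

Lemma measurable_cylinder w : measurable (cylinder hX w).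
Proof. exact: (@measurable_mkseq (size w) [set w]). Qed.

(** The product topology is a supremum of topologies, which by [cvg_sup] makes
    it easy to test convergence of a filter; so the filter that the cylinders
    around [om] generate is shown to converge to [om]. *)
Lemma nbhs_cylinder om (U : set (infseq hX)) : nbhs om U ->
  exists n, cylinder hX (mkseq om n) `<=` U.
Proof.
pose F : set_system (infseq hX) :=
  [set U | exists n, cylinder hX (mkseq om n) `<=` U].
have FF : Filter F.
  split; first by exists 0%N.
  - move=> A B [m mA] [n nB]; exists (maxn m n) => x.
    rewrite /cylinder/= size_mkseq => xom; split.
      apply: mA; rewrite /cylinder/= size_mkseq.
      by rewrite -!(@take_mkseq _ m (maxn m n)) ?leq_maxl// xom.
    apply: nB; rewrite /cylinder/= size_mkseq.
    by rewrite -!(@take_mkseq _ n (maxn m n)) ?leq_maxr// xom.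
  - by move=> A B AB [n nA]; exists n; exact: subset_trans AB.
suff FU : F --> om by move=> /FU.
apply/cvg_sup => i W [_ [[Z] oZ <-] Zom ZW].
exists i.+1; apply: subset_trans ZW => x; rewrite /cylinder /mkset size_mkseq.
move=> /(congr1 (fun s => nth (om 0%N) s i)); rewrite !nth_mkseq// => xom.
by move: Zom; rewrite /proj/= xom.
Qed.

(** The empty set is added to make the family stable under intersection. *)
Definition cylinders : set (set (infseq hX)) :=
  [set C | C = set0 \/ exists w, C = cylinder hX w].

Lemma cylinders_setI : setI_closed cylinders.
Proof.
move=> A B [->|[u ->]]; first by rewrite set0I; left.
case=> [->|[v ->]]; first by rewrite setI0; left.
wlog uv : u v / (size u <= size v)%N.
  move=> H; have [|/ltnW] := leqP (size u) (size v); first exact: H.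
  by rewrite setIC; exact: H.
have [[om [uom vom]]|nuv] := pselect (cylinder hX u `&` cylinder hX v !=set0).
  right; exists v; rewrite (cylinder_prefix uom vom uv).
  by rewrite setIidr// => x; exact: cylinder_cat.
by left; apply/eqP; apply: contrapT => /negP/set0P.
Qed.

(** There are countably many words, so an open set is the countable union of
    the cylinders that it contains. *)
Lemma measurable_cylindersE :
  @measurable _ (infseq hX) = <<s cylinders >>.
Proof.
apply/seteqP; split; last first.
  apply: smallest_sub; first exact: sigma_algebra_measurable.
  move=> _ [->|[w ->]]; [exact: measurable0|exact: measurable_cylinder].
apply: smallest_sub; first exact: smallest_sigma_algebra.
move=> U oU.
pose F n := if (unpickle n : option (seq X)) is Some w then
  if `[< cylinder hX w `<=` U >] then cylinder hX w else set0 else set0.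
have -> : U = \bigcup_n F n.
  apply/seteqP; split=> [om Uom|om [n _]].
    have [n nU] := nbhs_cylinder (open_nbhs_nbhs (conj oU Uom)).
    exists (pickle (mkseq om n)) => //; rewrite /F pickleK.
    by case: asboolP => // _; exact: mem_cylinder.
  by rewrite /F; case: unpickle => [w|//]; case: asboolP => // + ?; exact.
have [s0 _ sU] := smallest_sigma_algebra setT cylinders.
apply: sU => n; apply: sub_sigma_algebra.
rewrite /F; case: unpickle => [w|]; last by left.
by case: asboolP => _; [right; exists w|left].
Qed.

Lemma cylinder_measure_unique (R : realType)
    (m1 m2 : {measure set (infseq hX) -> \bar R}) :
  m1 setT < +oo -> (forall w, m1 (cylinder hX w) = m2 (cylinder hX w)) ->
  forall E, measurable E -> m1 E = m2 E.
Proof.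
move=> m1T m12; apply: (measure_unique cylinders (fun=> setT)) => //.
- exact: measurable_cylindersE.
- exact: cylinders_setI.
- move=> _; right; exists [::]; apply/seteqP; by split.
- exact: bigcup_const.
- by move=> _ [->|[w ->]]; rewrite ?measure0.
Qed.

End cylinders.

(** * Exponential decay of cylinders in a non-atomic Markov measure *)
Section transitions.
Variables (X : finType) (R : realType) (L : X -> X -> R) (l : X -> R).
Hypotheses (L_st : stochastic L) (l_prob : prob_vector l)
  (l_st : stationary L l).
Implicit Types (x y : X) (u v : seq X).
Local Close Scope ereal_scope.

Definition path_prob x u : R := \prod_(c <- pairmap L x u) c.

Lemma path_prob_nil x : path_prob x [::] = 1.
Proof. by rewrite /path_prob /= big_nil. Qed.

Lemma path_prob_cons x y u : path_prob x (y :: u) = L x y * path_prob y u.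
Proof. by rewrite /path_prob /= big_cons. Qed.

Lemma path_prob_cat x u v :
  path_prob x (u ++ v) = path_prob x u * path_prob (last x u) v.
Proof. by rewrite /path_prob pairmap_cat big_cat. Qed.

Lemma transition_ge0 x y : 0 <= L x y. Proof. exact: L_st.1. Qed.

Lemma transition_le1 x y : L x y <= 1.
Proof.
rewrite -(L_st.2 x) (bigD1 y)//= lerDl sumr_ge0// => z _.
exact: transition_ge0.
Qed.

Lemma path_prob_ge0 x u : 0 <= path_prob x u.
Proof.
elim: u x => [|y u IH] x; first by rewrite path_prob_nil.
by rewrite path_prob_cons mulr_ge0// transition_ge0.
Qed.

Lemma path_prob_le1 x u : path_prob x u <= 1.
Proof.
elim: u x => [|y u IH] x; first by rewrite path_prob_nil.
by rewrite path_prob_cons mulr_ile1// ?transition_ge0 ?path_prob_ge0//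
  transition_le1.
Qed.

(** Stationarity propagates positivity of [l] along transitions of positive
    probability; this is where invariance under the shift enters. *)
Lemma path_prob_last_gt0 x u : 0 < l x -> 0 < path_prob x u ->
  0 < l (last x u).
Proof.
elim: u x => [//|y u IH] x lx; rewrite path_prob_cons => p0 /=.
have Lxy0 : 0 < L x y.
  rewrite lt_neqAle transition_ge0 andbT eq_sym; apply: contraTneq p0 => ->.
  by rewrite mul0r ltxx.
apply: IH; last by rewrite pmulr_rgt0 in p0.
rewrite -l_st (bigD1 x)//= ltr_pwDl ?mulr_gt0// sumr_ge0// => z _.
by rewrite mulr_ge0// ?transition_ge0 ?l_prob.1.
Qed.

(** The successor of [x] when it is almost sure; elsewhere the value [x] is
    arbitrary and only serves to make [forced] a function on [X], so that the
    theory of orbits applies. *)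
Definition forced x : X := odflt x [pick y | L x y == 1].

Lemma forcedP x y : L x y = 1 -> forced x = y.
Proof.
rewrite /forced => Lxy; case: pickP => [z /eqP Lxz /=|/(_ y)]; last first.
  by rewrite Lxy eqxx.
apply/eqP; apply: contraT => zy; have := L_st.2 x.
rewrite (bigD1 y)//= (bigD1 z)//= Lxy Lxz.
set S := \sum_(_ | _) _; suff : 0 <= S by move=> S0 e; exfalso; lra.
by rewrite sumr_ge0// => t _; exact: transition_ge0.
Qed.

Lemma path_prob_eq1 x u : path_prob x u = 1 ->
  forall i, (i < size u)%N ->
  L (iter i forced x) (iter i.+1 forced x) = 1.
Proof.
elim: u x => [//|y u IH] x; rewrite path_prob_cons => p1.
have Lxy : L x y = 1.
  apply/eqP; rewrite eq_le transition_le1/= -[leLHS]p1 ler_piMr//.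
    exact: transition_ge0.
  exact: path_prob_le1.
move: p1; rewrite Lxy mul1r => /IH p1 [_|i iu] /=.
  by rewrite (forcedP Lxy).
by move: (p1 i iu); rewrite -{1 2}(forcedP Lxy) /= -!iterSr.
Qed.

(** The orbit of [x] under [forced] has at most [#|X|] points, so [#|X|]
    almost sure steps visit all of it, and every later step repeats one of
    them. *)
Lemma forced_forever x u : size u = #|X| -> path_prob x u = 1 ->
  forall i, L (iter i forced x) (iter i.+1 forced x) = 1.
Proof.
move=> su p1 i; have xi := fconnect_iter forced i x.
rewrite iterS -(iter_findex xi) -iterS.
apply: (path_prob_eq1 p1); rewrite su.
by apply: leq_trans (findex_max xi) _; exact: max_card.
Qed.

Lemma path_prob_forced x :
  (forall i, L (iter i forced x) (iter i.+1 forced x) = 1) -> forall n,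
  path_prob x (mkseq (fun i => iter i.+1 forced x) n) = 1.
Proof.
move=> H; elim=> [|n IH]; first by rewrite path_prob_nil.
rewrite mkseqS -cats1 path_prob_cat IH mul1r path_prob_cons path_prob_nil mulr1.
suff -> : last x (mkseq (fun i => iter i.+1 forced x) n) = iter n forced x.
  by [].
by case: n {IH} => [//|n]; rewrite mkseqS last_rcons.
Qed.

Lemma path_prob_exp q k : (0 <= q) ->
  (forall x u, 0 < l x -> size u = k -> path_prob x u <= q) ->
  forall m x u, 0 < l x -> size u = (k * m)%N -> path_prob x u <= q ^+ m.
Proof.
move=> q0 qk; elim=> [|m IH] x u lx su.
  by rewrite expr0 path_prob_le1.
rewrite -(cat_take_drop k u) path_prob_cat exprS.
have su1 : size (take k u) = k by rewrite size_takel// su mulnS leq_addr.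
have := path_prob_ge0 x (take k u).
rewrite le_eqVlt => /orP[/eqP <-|p0].
  by rewrite mul0r mulr_ge0// exprn_ge0.
rewrite ler_pM ?path_prob_ge0 ?qk//.
apply: IH; first exact: path_prob_last_gt0.
by rewrite size_drop su mulnS addKn.
Qed.

End transitions.

Lemma bernoulli_inequality (R : realDomainType) (a : R) k : (0 <= a <= 1)%R ->
  (1 - k%:R * a <= (1 - a) ^+ k)%R.
Proof.
move=> /andP[a0 a1]; elim: k => [|k IH]; first by rewrite mul0r subr0 expr0.
rewrite exprS; apply: (@le_trans _ _ ((1 - a) * (1 - k%:R * a))%R); last first.
  by rewrite ler_wpM2l// subr_ge0.
have ka : (0 <= k%:R * a * a)%R by rewrite !mulr_ge0.
by rewrite -natr1; lra.
Qed.

Section decay.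
Variables (X : finType) (hX : (1 < #|X|)%N) (R : realType).
Variable mu : probability (infseq hX) R.
Hypothesis mu_na : non_atomic mu.
Local Close Scope ereal_scope.

Lemma non_atomic_cvg (om : infseq hX) :
  mu (cylinder hX (mkseq om n)) @[n --> \oo] --> 0%E.
Proof.
rewrite -(mu_na om) set1_bigcap_cylinder.
have mc n : measurable (cylinder hX (mkseq om n)) by exact: measurable_cylinder.
apply: (@nonincreasing_cvg_mu _ _ _ mu
  (fun n => cylinder hX (mkseq om n))) => //.
- by rewrite (le_lt_trans (probability_le1 _ _))// ltry.
- exact: bigcap_measurable.
- move=> m n mn; apply/subsetPset => x.
  rewrite -{1}(cat_take_drop m (mkseq om n)) take_mkseq//.
  exact: cylinder_cat.
Qed.

Variables (L : X -> X -> R) (l : X -> R).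
Hypotheses (L_st : stochastic L) (l_prob : prob_vector l)
  (l_st : stationary L l).
Hypothesis muE : forall (x : X) (u : seq X),
  mu (cylinder hX (x :: u)) = (l x * path_prob L x u)%:E.

(** Otherwise the chain started at [x] follows a single sequence almost
    surely, and that sequence is an atom of mass [l x]. *)
Lemma path_prob_lt1 x u : 0 < l x -> size u = #|X| -> path_prob L x u < 1.
Proof.
move=> lx su; rewrite lt_neqAle path_prob_le1// andbT; apply/eqP => p1.
have H := path_prob_forced (forced_forever L_st su p1).
pose om : infseq hX := fun n => iter n (forced L) x.
have mu_om n : mu (cylinder hX (mkseq om n.+1)) = (l x)%:E.
  rewrite /mkseq /= (iotaDl 1 0) -map_comp muE.
  by rewrite [X in (_ * X)%:E]H mulr1.
have cvg_l : mu (cylinder hX (mkseq om n)) @[n --> \oo] --> (l x)%:E.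
  by apply: cvg_near_cst; exists 1%N => // -[|n] // _; exact: mu_om.
have := cvg_unique (@ereal_hausdorff R) cvg_l (non_atomic_cvg om).
by move=> /(_ _) => -[l0]; rewrite l0 ltxx in lx.
Qed.

Lemma path_prob_lt1_unif : exists2 q : R, 0 <= q < 1 &
  forall x u, 0 < l x -> size u = #|X| -> path_prob L x u <= q.
Proof.
pose q := \big[Num.max/0]_(p : X * #|X|.-tuple X | 0 < l p.1)
  path_prob L p.1 p.2.
exists q => [|x u lx /eqP su].
  rewrite /q; elim/big_ind : _ => [|a b /andP[a0 a1] /andP[b0 b1]|[x u]/= lx].
  - by rewrite lexx ltr01.
  - by rewrite le_max a0 gt_max a1.
  - by rewrite path_prob_ge0// path_prob_lt1// size_tuple.
exact: (le_bigmax_cond _ (fun p : X * #|X|.-tuple X => path_prob L p.1 p.2)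
  (j := (x, Tuple su))).
Qed.

(** Over each block of [#|X|] steps the mass is multiplied by at most some
    [q < 1]. To turn this into a geometric bound at all depths one needs [r < 1]
    with [q <= r ^+ #|X|]; Bernoulli's inequality supplies
    [r = 1 - (1 - q) / #|X|]. *)
Lemma cylinder_decay : exists C r : R, [/\ 0 <= C, 0 < r < 1 &
  forall u, (mu (cylinder hX u) <= (C * r ^+ size u)%:E)%E].
Proof.
have [q /andP[q0 q1] Hq] := path_prob_lt1_unif.
have Xgt1 : 1 < #|X|%:R :> R by rewrite ltr1n.
have X0 : 0 < #|X|%:R :> R by rewrite (lt_trans _ Xgt1).
pose a := (1 - q) / #|X|%:R; pose r := 1 - a.
have a0 : 0 < a by rewrite divr_gt0// subr_gt0.
have a1 : a < 1.
  by rewrite ltr_pdivrMr// mul1r (le_lt_trans _ Xgt1)// gerBl.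
have qr : q <= r ^+ #|X|.
  apply: le_trans (bernoulli_inequality #|X| _); last by rewrite !ltW.
  by rewrite /a mulrCA divff ?gt_eqF// mulr1 subKr.
have r0 : 0 < r by rewrite subr_gt0.
have r1 : r < 1 by rewrite gtrBl.
(* The factor [r ^- #|X|] pays for the incomplete last block and for the first
   letter, whose mass [l x] is only bounded by 1. *)
exists (r ^- #|X|), r; split; [by rewrite invr_ge0 exprn_ge0// ltW|exact/andP|].
case=> [|x u].
  rewrite cylinder_nil probability_setT expr0 mulr1 lee_fin.
  by rewrite invf_ge1 ?exprn_gt0// exprn_ile1// ltW.
rewrite muE lee_fin.
have := l_prob.1 x; rewrite le_eqVlt => /orP[/eqP <-|lx].
  by rewrite mul0r mulr_ge0// ?invr_ge0 exprn_ge0// ltW.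
have lx1 : l x <= 1.
  rewrite -l_prob.2 (bigD1 x)//= lerDl sumr_ge0// => y _; exact: l_prob.1.
pose m := (size u %/ #|X|)%N.
apply: (@le_trans _ _ (q ^+ m)).
  rewrite -[leRHS]mul1r ler_pM ?path_prob_ge0 ?l_prob.1//.
  rewrite -(cat_take_drop (#|X| * m) u) path_prob_cat.
  apply: (@le_trans _ _ (path_prob L x (take (#|X| * m) u))).
    by rewrite ler_piMr ?path_prob_ge0 ?path_prob_le1.
  apply: (path_prob_exp L_st l_prob l_st q0 Hq) => //.
  by rewrite size_takel// mulnC leq_trunc_div.
apply: (@le_trans _ _ (r ^+ (#|X| * m))).
  by rewrite exprM lerXn2r ?nnegrE// exprn_ge0// ltW.
rewrite mulrC ler_pdivlMr ?exprn_gt0// -exprD.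
apply: ler_wiXn2l; [exact: ltW|exact: ltW|].
by rewrite /= mulnC -mulSnr ltn_ceil// ltnW.
Qed.

End decay.

(** * Subexponential activity and null sets *)
Section nontrivial_words.
Variables (X : finType) (g : treeEndo X).
Implicit Types (u v w s : seq X).

Lemma trivial_restr_cat u v : trivial_restr g u -> g (u ++ v) = g u ++ v.
Proof. by move=> gu; rewrite restrP gu. Qed.

Lemma trivial_restr_ext u v : trivial_restr g u -> trivial_restr g (u ++ v).
Proof.
move=> gu w; rewrite /restr -catA trivial_restr_cat// catA -trivial_restr_cat//.
by rewrite -(tree_size g (u ++ v)) drop_size_cat.
Qed.

Definition tree_tuple n (t : n.-tuple X) : n.-tuple X :=
  Tuple (introT eqP (etrans (tree_size g t) (size_tuple t))).

Definition nonV_tuples n : {set n.-tuple X} :=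
  finset (fun t : n.-tuple X => ~~ `[< V g t >]).

(** A word outside [V g] is by definition the image of a word where the
    restriction of [g] is nontrivial. *)
Lemma card_nonV n : (#|nonV_tuples n| <= activity g n)%N.
Proof.
rewrite /activity -[leqRHS]cardsE.
apply: leq_trans (leq_imset_card (@tree_tuple n) _).
apply: subset_leq_card; apply/fintype.subsetP => t; rewrite inE.
move=> /asboolPn nVt.
have [u [gu nu]] : exists u, g u = t /\ ~ trivial_restr g u.
  apply: contrapT => H; apply: nVt => u gu; apply: contrapT => nu.
  by apply: H; exists u.
have su : size u == n by rewrite -(tree_size g u) gu size_tuple.
apply/imsetP; exists (Tuple su); last by apply: val_inj; rewrite /= gu.
by rewrite inE; apply/mem_set/asboolPn.
Qed.

End nontrivial_words.

Section null_sets.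
Variables (X : finType) (hX : (1 < #|X|)%N) (R : realType).
Variables (mu : probability (infseq hX) R) (g : treeEndo X).
Hypotheses (mu_markov : is_markov mu) (mu_na : non_atomic mu)
  (g_subexp : subexponential_activity R g).

Definition initial (om : infseq hX) n : n.-tuple X :=
  Tuple (introT eqP (size_mkseq om n)).

Lemma measure_le_cylinders n (S : {set n.-tuple X}) (E : set (infseq hX))
    (b : R) :
  measurable E -> (forall om, E om -> initial om n \in S) ->
  (forall t, t \in S -> mu (cylinder hX t) <= b%:E) ->
  mu E <= (#|S|%:R * b)%:E.
Proof.
move=> mE ES Sb.
have := @content_sub_fsum _ _ _ mu _ [set` enum S] E
  (fun t : n.-tuple X => cylinder hX t).
move=> /(_ (finite_seq _)) h; apply: le_trans (h _ mE _) _.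
- by move=> t _; exact: measurable_cylinder.
- move=> om /ES tS; exists (initial om n); first by rewrite /= mem_enum.
  exact: mem_cylinder.
- rewrite -fsbig_seq ?enum_uniq//.
  apply: (@le_trans _ _ (\sum_(t <- enum S) b%:E)).
    by rewrite big_seq [leRHS]big_seq; apply: lee_sum => t;
      rewrite mem_enum => /Sb.
  rewrite sumEFin lee_fin big_const_seq count_predT -cardE iter_addr addr0.
  by rewrite mulr_natl.
Qed.

(** Exponential decay at any rate outweighs subexponential growth: [c > 1] can be
    chosen so close to 1 that [c * r < 1], and the total mass of the covering
    cylinders of depth [n] is then at most [C * (c * r) ^+ n]. *)
Lemma null_of_few_cylinders (E : set (infseq hX)) : measurable E ->
  (\forall n \near \oo, exists S : {set n.-tuple X},
    (#|S| <= activity g n)%N /\ forall om, E om -> initial om n \in S) ->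
  mu E = 0.
Proof.
move=> mE Ecov.
have [L [l [L_st l_prob l_st muE]]] := mu_markov.
have [C [r [C0 /andP[r0 r1] Cr]]] := cylinder_decay mu_na L_st l_prob l_st muE.
(* Any [c] with [1 < c < 1 / r] would do. *)
pose c : R := (2 / (1 + r))%R.
have c1 : (1 < c)%R by rewrite ltr_pdivlMr; lra.
have cr1 : (`|c * r| < 1)%R.
  rewrite ger0_norm; last by rewrite mulr_ge0//; lra.
  by rewrite /c mulrAC ltr_pdivrMr; lra.
have Efin : mu E \is a fin_num by exact: fin_num_measure.
apply/eqP; rewrite eq_le measure_ge0 andbT -(fineK Efin) lee_fin.
have cvg0 : (C * (c * r) ^+ n)%R @[n --> \oo] --> (0 : R)%R.
  by rewrite -(mulr0 C); apply: cvgMr; exact: cvg_expr.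
apply: (cvgr_to_ge cvg0).
near=> n.
have [S [Sact ES]] : exists S : {set n.-tuple X},
    (#|S| <= activity g n)%N /\ forall om, E om -> initial om n \in S.
  by near: n.
have actn : ((activity g n)%:R <= c ^+ n)%R by near: n; exact: g_subexp.
rewrite -lee_fin (fineK Efin).
apply: (le_trans (measure_le_cylinders mE ES (b := C * r ^+ n) _)).
  by move=> t _; have := Cr t; rewrite size_tuple.
rewrite lee_fin exprMn mulrCA ler_wpM2l// ler_wpM2r ?exprn_ge0 ?(ltW r0)//.
by rewrite (le_trans _ actn)// ler_nat.
Unshelve. all: by end_near.
Qed.

End null_sets.

(** * The exceptional set and its preimage *)
Section exceptional_set.
Variables (X : finType) (hX : (1 < #|X|)%N) (R : realType).
Variables (mu : probability (infseq hX) R) (g : treeEndo X).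
Hypotheses (mu_markov : is_markov mu) (mu_na : non_atomic mu)
  (g_subexp : subexponential_activity R g).
Implicit Types (u v w s : seq X) (om : infseq hX).

Definition exceptional : set (infseq hX) :=
  [set om | forall n, ~ V g (mkseq om n)].

Lemma measurable_forall_mkseq (P : set (seq X)) :
  measurable [set om : infseq hX | forall n, P (mkseq om n)].
Proof.
have -> : [set om : infseq hX | forall n, P (mkseq om n)] =
    \bigcap_n [set om | P (mkseq om n)].
  by apply/seteqP; split=> [om Pom n _|om Pom n]; [exact: Pom|exact: (Pom n I)].
by apply: bigcap_measurable => // n _; exact: measurable_mkseq.
Qed.

Lemma measurable_exceptional : measurable exceptional.
Proof. exact: (measurable_forall_mkseq (fun u => ~ V g u)). Qed.

Lemma measurable_boundary_preimage (E : set (infseq hX)) :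
  measurable E -> measurable (boundary g @^-1` E).
Proof.
by move=> mE; rewrite -[X in measurable X]setTI; exact: boundary_measurable.
Qed.

Lemma never_trivial_null :
  mu [set om | forall n, ~ trivial_restr g (mkseq om n)] = 0.
Proof.
apply: (null_of_few_cylinders mu_markov mu_na g_subexp).
  exact: (measurable_forall_mkseq (fun u => ~ trivial_restr g u)).
apply: nearW => n.
exists (finset (fun t : n.-tuple X => ~~ `[< trivial_restr g t >])).
split=> [|om nt]; last by rewrite inE; apply/asboolPn; exact: nt.
rewrite cardsE /activity; apply: subset_leq_card.
by apply/fintype.subsetP => t nt; apply/mem_set.
Qed.

(** Below [u] the map [g] is injective on words, since it only replaces the
    prefix [u] by [g u]; so the preimages below [u] of the words outside [V g]
    are not more numerous than these words. *)
Lemma exceptional_preimage_trivial_null u : trivial_restr g u ->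
  mu (cylinder hX u `&` boundary g @^-1` exceptional) = 0.
Proof.
move=> gu; apply: (null_of_few_cylinders mu_markov mu_na g_subexp).
  apply: measurableI; first exact: measurable_cylinder.
  by apply: measurable_boundary_preimage; exact: measurable_exceptional.
near=> n; pose S := finset (fun t : n.-tuple X =>
  (prefix u t) && (tree_tuple g t \in nonV_tuples g n)).
exists S; split.
  apply: leq_trans (card_nonV g n).
  rewrite -(card_in_imset (f := @tree_tuple _ g n) (D := S)); last first.
    move=> t t'; rewrite !inE => /andP[/prefixP[v tv] _].
    move=> /andP[/prefixP[v' tv'] _].
    move=> /(congr1 val) /=; rewrite tv tv' !trivial_restr_cat// => /eqP.
    rewrite eqseq_cat// eqxx => /eqP vv'.
    by apply: val_inj; rewrite /= tv tv' vv'.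
  apply/subset_leq_card/fintype.subsetP => _ /imsetP[t + ->].
  by rewrite inE => /andP[].
move=> om [uom Aom]; rewrite inE; apply/andP; split.
  have nu : (size u <= n)%N by near: n; exact: nbhs_infty_ge.
  rewrite -{1}(uom : mkseq om (size u) = u) -(@take_mkseq _ _ om _ n)//.
  exact: prefix_take.
by rewrite inE; apply/asboolPn; rewrite /= -boundaryP; exact: Aom.
Unshelve. all: by end_near.
Qed.

(** Almost every sequence has a prefix [u] where the restriction of [g] is
    trivial, and there are countably many words [u]. *)
Lemma exceptional_preimage_null : mu (boundary g @^-1` exceptional) = 0.
Proof.
have mA := measurable_boundary_preimage measurable_exceptional.
pose B := [set om : infseq hX | forall n, ~ trivial_restr g (mkseq om n)].
pose E k := if (unpickle k : option (seq X)) is Some u then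
  if `[< trivial_restr g u >]
  then cylinder hX u `&` boundary g @^-1` exceptional else set0 else set0.
apply/(negligibleP _ mA).
apply: (@negligibleS _ _ _ _ (B `|` \bigcup_k E k)).
  move=> om Aom; have [Bom|nBom] := pselect (B om); first by left.
  right; have [n tn] : exists n, trivial_restr g (mkseq om n).
    by apply: contrapT => H; apply: nBom => n tn; apply: H; exists n.
  exists (pickle (mkseq om n)) => //; rewrite /E pickleK.
  by case: asboolP => // _; split=> //; exact: mem_cylinder.
apply: negligibleU.
  apply/negligibleP; last exact: never_trivial_null.
  exact: (measurable_forall_mkseq (fun u => ~ trivial_restr g u)).
apply: negligible_bigcup => k; rewrite /E.
case: unpickle => [u|]; last exact: negligible_set0.
case: asboolP => [gu|_]; last exact: negligible_set0.
apply/negligibleP; last exact: exceptional_preimage_trivial_null.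
by apply: measurableI => //; exact: measurable_cylinder.
Qed.

End exceptional_set.

(** * Proportionality of the two measures below the words of [V g] *)
Section local_proportionality.
Variables (X : finType) (hX : (1 < #|X|)%N) (R : realType).
Variables (mu : probability (infseq hX) R) (g : treeEndo X).
Hypotheses (mu_markov : is_markov mu).
Implicit Types (u v w s : seq X) (om : infseq hX).
Local Notation nu := (distribution mu (boundary g)).

Lemma boundary_preimage_cylinder w s : V g w ->
  boundary g @^-1` cylinder hX (w ++ s) =
  \bigcup_(t in [set t : (size w).-tuple X | g t = w]) cylinder hX (t ++ s).
Proof.
move=> Vw; apply/seteqP; split=> om.
  rewrite /preimage /cylinder /mkset size_cat boundaryP => gom.
  have omE := cat_take_drop (size w) (mkseq om (size w + size s)).
  move: omE gom; rewrite take_mkseq ?leq_addr// => <- gom.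
  have gw : g (mkseq om (size w)) = w.
    have := congr1 (take (size w)) gom; rewrite take_size_cat// => {2}<-.
    by rewrite -[X in take X _](size_mkseq om) tree_take.
  exists (initial om (size w)) => //=.
  move: gom; rewrite trivial_restr_cat; last exact: Vw.
  rewrite gw => /eqP; rewrite eqseq_cat// eqxx /= => /eqP ds.
  rewrite size_cat size_mkseq -[in RHS]ds.
  rewrite -[in RHS](take_mkseq om (leq_addr (size s) (size w))).
  by rewrite cat_take_drop.
move=> [t /= gt]; rewrite /preimage /cylinder /mkset !size_cat size_tuple.
by rewrite boundaryP => ->; rewrite trivial_restr_cat ?gt//; exact: Vw.
Qed.

Lemma distribution_cylinder_V w s : V g w -> nu (cylinder hX (w ++ s)) =
  \sum_(t \in [set t : (size w).-tuple X | g t = w]) mu (cylinder hX (t ++ s)).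
Proof.
move=> Vw; rewrite /distribution /pushforward boundary_preimage_cylinder//.
rewrite measure_fin_bigcup//.
- exact: finite_finset.
- move=> t t' _ _ [om [/cylinder_cat tom /cylinder_cat t'om]].
  by apply: val_inj; apply: (cylinder_eq tom t'om); rewrite !size_tuple.
- by move=> t _; exact: measurable_cylinder.
Qed.

(** The factor depends on the prefix [rcons u x] only through its last
    letter. *)
Lemma cylinder_markov_property : exists P : X -> seq X -> R,
  forall u x v, mu (cylinder hX (u ++ x :: v)) =
    mu (cylinder hX (rcons u x)) * (P x v)%:E.
Proof.
have [L [l [_ _ _ muE]]] := mu_markov.
exists (path_prob L) => -[|y u] x v.
  by rewrite /= !muE /= big_nil mulr1 -EFinM.
rewrite /= !muE -cats1 -EFinM -mulrA; congr ((l y * _)%:E).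
rewrite -!/(path_prob _ _ _) -cat_rcons -cats1.
by rewrite [LHS]path_prob_cat last_cat.
Qed.

(** It suffices to compare both sides on the cylinders of
    [rcons w x ++ v]. There each preimage contributes the same factor [P x v],
    which therefore comes out of the sum over the preimages of [w]. *)
Lemma distribution_proportional w x : V g w ->
  mu (cylinder hX (rcons w x)) <> 0 -> forall E, measurable E ->
  nu (E `&` cylinder hX (rcons w x)) =
  nu (cylinder hX (rcons w x)) / mu (cylinder hX (rcons w x))
    * mu (E `&` cylinder hX (rcons w x)).
Proof.
move=> Vw muC; have [P muP] := cylinder_markov_property.
set C := cylinder hX (rcons w x) in muC *.
have mC : measurable C := @measurable_cylinder _ hX (rcons w x).
have nuP v : nu (cylinder hX (w ++ x :: v)) = nu C * (P x v)%:E.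
  rewrite /C -cats1 !distribution_cylinder_V// ge0_mule_fsuml; last first.
    by move=> t; exact: measure_ge0.
  by apply: eq_fsbigr => t _; rewrite muP cats1.
have K0 : (0 <= fine (nu C) / fine (mu C))%R.
  by rewrite divr_ge0// fine_ge0// measure_ge0.
have muCr : (fine (mu C) != 0)%R.
  by rewrite fine_eq0 ?fin_num_measure//; apply/eqP.
have -> : nu C / mu C = (fine (nu C) / fine (mu C))%:E.
  rewrite -[X in X / _]fineK ?fin_num_measure//.
  rewrite -[X in _ / X]fineK ?fin_num_measure//.
  by rewrite inver (negbTE muCr) -EFinM.
move=> E mE.
apply: (@cylinder_measure_unique _ _ _ (mrestr nu mC)
  (mscale (NngNum K0) (mrestr mu mC))) => //.
  by rewrite /mrestr /= (le_lt_trans (probability_le1 _ _))// ?ltry//;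
    exact: measurableI.
move=> v; change (nu (cylinder hX v `&` C) =
  (fine (nu C) / fine (mu C))%:E * mu (cylinder hX v `&` C)).
have nuCE : nu C = (fine (nu C) / fine (mu C))%:E * mu C.
  rewrite -[in RHS](@fineK _ (mu C)) ?fin_num_measure// -EFinM divfK//.
  by rewrite fineK// fin_num_measure.
have [[om [vom Com]]|nvC] := pselect (cylinder hX v `&` C !=set0); last first.
  suff -> : cylinder hX v `&` C = set0 by rewrite !measure0 mule0.
  by apply/eqP; apply: contrapT => /negP/set0P.
have [vC|/ltnW Cv] := leqP (size v) (size (rcons w x)).
  rewrite setIidr// => om'; rewrite /C (cylinder_prefix vom Com vC).
  exact: cylinder_cat.
rewrite setIidl; last first.
  by move=> om'; rewrite (cylinder_prefix Com vom Cv); exact: cylinder_cat.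
rewrite (cylinder_prefix Com vom Cv) cat_rcons nuP muP -/C muleA.
by congr (_ * _).
Qed.

End local_proportionality.

(** * Decomposition along [Vmax g] and the density *)
Section decomposition.
Variables (X : finType) (hX : (1 < #|X|)%N) (R : realType).
Variables (mu : probability (infseq hX) R) (g : treeEndo X).
Hypotheses (mu_markov : is_markov mu) (mu_na : non_atomic mu)
  (g_subexp : subexponential_activity R g).
Implicit Types (u v w s : seq X) (om : infseq hX).
Local Notation nu := (distribution mu (boundary g)).

Lemma Vmax_exists om n : V g (mkseq om n) -> exists m, Vmax g (mkseq om m).
Proof.
move=> /asboolP Vn.
have exV : exists n, `[< V g (mkseq om n) >] by exists n.
exists (ex_minn exV); case: ex_minnP => m /asboolP Vm minm; split=> // v Vv.
move=> [/prefixP[s ms]]; apply.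
have sm : (size v <= m)%N.
  by rewrite -(size_mkseq om m) ms size_cat leq_addr.
have ve : v = mkseq om (size v).
  by rewrite -(@take_mkseq _ _ om _ m)// ms take_size_cat.
rewrite ve; congr mkseq; apply/eqP; rewrite eqn_leq sm minm//.
by apply/asboolP; rewrite -ve.
Qed.

Lemma Vmax_disjoint w w' om : Vmax g w -> Vmax g w' ->
  cylinder hX w om -> cylinder hX w' om -> w = w'.
Proof.
wlog ww' : w w' / (size w <= size w')%N.
  move=> H Vw Vw' wom w'om; have [|/ltnW] := leqP (size w) (size w').
    by move=> ?; exact: H.
  by move=> ?; apply/esym; exact: H.
move=> [Vw _] [_ maxw'] wom w'om; apply: contrapT => neq.
apply: (maxw' _ Vw); split=> //.
by rewrite (cylinder_prefix wom w'om ww') prefix_prefix.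
Qed.

(** The cylinders of [rcons w x] with [w] in [Vmax g], listed by the
    enumeration of all pairs of a word and a letter, so that the theory of
    countable sums of measures applies. *)
Definition piece (k : nat) : set (infseq hX) :=
  if (pickle_inv k : option (seq X * X)) is Some p then
    if `[< Vmax g p.1 >] then cylinder hX (rcons p.1 p.2) else set0
  else set0.

Lemma piece_pickle (p : seq X * X) : Vmax g p.1 ->
  piece (pickle p) = cylinder hX (rcons p.1 p.2).
Proof. by move=> Vp; rewrite /piece pickleK_inv; case: asboolP. Qed.

Lemma pieceP k : piece k = set0 \/ exists p : seq X * X,
  [/\ k = pickle p, Vmax g p.1 & piece k = cylinder hX (rcons p.1 p.2)].
Proof.
have := pickle_invK (T := (seq X * X)%type) k; rewrite /piece.
case: pickle_inv => [p|_]; last by left.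
by move=> /= <-; case: asboolP => Vp; [right; exists p|left].
Qed.

Lemma measurable_piece k : measurable (piece k).
Proof.
by have [->|[p [_ _ ->]]] := pieceP k; [|exact: measurable_cylinder].
Qed.

Lemma trivIset_piece : trivIset setT piece.
Proof.
move=> j k _ _ [om []]; have [->//|[p [-> Vp ->]]] := pieceP j.
have [->//|[q [-> Vq ->]]] := pieceP k.
rewrite -!cats1 => pom qom.
have pq1 := Vmax_disjoint Vp Vq (cylinder_cat pom) (cylinder_cat qom).
have := cylinder_eq pom qom; rewrite !size_cat pq1 => /(_ erefl).
move=> /eqP; rewrite eqseq_cat// eqxx /= => /eqP[pq2].
by case: p q pq1 pq2 {Vp Vq pom qom} => [p1 p2] [q1 q2] /= -> ->.
Qed.

Lemma bigcup_piece om : ~ exceptional g om -> (\bigcup_k piece k) om.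
Proof.
move=> nA; have [n Vn] : exists n, V g (mkseq om n).
  by apply: contrapT => H; apply: nA => n Vn; apply: H; exists n.
have [m Vm] := Vmax_exists Vn.
exists (pickle (mkseq om m, om m)) => //; rewrite piece_pickle//= -mkseqS.
exact: mem_cylinder.
Qed.

Definition coef k : \bar R :=
  if mu (piece k) == 0 then 0 else nu (piece k) / mu (piece k).

Lemma coef_ge0 k : 0 <= coef k.
Proof.
rewrite /coef; case: ifP => // _.
by rewrite mule_ge0 ?inve_ge0 ?measure_ge0.
Qed.

Lemma densityE om :
  density mu g om = \sum_(0 <= k <oo) coef k * (\1_(piece k) om)%:E.
Proof.
rewrite nneseries_esumT; last first.
  by move=> k; rewrite mule_ge0 ?coef_ge0// lee_fin.
rewrite /density; set D := [set p | _].
have pickle_inj : set_inj D pickle by move=> p q _ _; exact: (pcan_inj pickleK).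
transitivity (\esum_(k in pickle @` D) (coef k * (\1_(piece k) om)%:E)).
  rewrite esum_image//; apply: eq_esum => p [Vp mup].
  by rewrite /coef piece_pickle//; case: eqP.
rewrite esum_mkcond; apply: eq_esum => k _; case: ifPn => // /negP kD.
rewrite /coef; case: eqP => [_|muk]; first by rewrite mul0e.
have [pk|[p [kp Vp pk]]] := pieceP k; first by rewrite pk measure0 in muk.
by exfalso; apply: kD; apply/mem_set; exists p => //; rewrite /D /= -pk.
Qed.

Lemma measurable_density : measurable_fun [set: infseq hX] (density mu g).
Proof.
rewrite (funext densityE).
apply: ge0_emeasurable_sum => [k om _ _|k _].
  by rewrite mule_ge0 ?coef_ge0// lee_fin.
apply: measurable_funeM; apply/measurable_EFinP.
by apply: measurable_indic; exact: measurable_piece.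
Qed.

Lemma integral_density E : measurable E ->
  \int[mu]_(om in E) density mu g om =
  \sum_(0 <= k <oo) coef k * mu (E `&` piece k).
Proof.
move=> mE; under eq_integral do rewrite densityE.
have mk k : measurable_fun E (fun om => (\1_(piece k) om)%:E : \bar R).
  apply/measurable_EFinP.
  by apply: measurable_indic; exact: measurable_piece.
rewrite integral_nneseries//; last 2 first.
- by move=> k; apply: measurable_funeM.
- by move=> k om _; rewrite mule_ge0 ?coef_ge0// lee_fin.
apply: eq_eseriesr => k _; rewrite ge0_integralZl ?coef_ge0//.
by rewrite (integral_indic _ mE (measurable_piece k)) (setIC (piece k)).
Qed.

Hypothesis null_children : forall w x, Vmax g w ->
  mu (cylinder hX (rcons w x)) = 0 ->
  mu (boundary g @^-1` cylinder hX (rcons w x)) = 0.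

Lemma distribution_piece E k : measurable E ->
  nu (E `&` piece k) = coef k * mu (E `&` piece k).
Proof.
move=> mE; have [->|[[w x] [/= _ Vw pk]]] := pieceP k.
  by rewrite setI0 !measure0 mule0.
rewrite /coef pk; case: eqP => [mu0|mu0]; last first.
  exact: (distribution_proportional mu_markov (proj1 Vw) mu0 mE).
rewrite mul0e; apply/eqP; rewrite eq_le measure_ge0 andbT.
rewrite -(null_children Vw mu0).
have mC := @measurable_cylinder _ hX (rcons w x).
have mEC := measurable_boundary_preimage g (measurableI _ _ mE mC).
have mgC := measurable_boundary_preimage g mC.
apply: (le_measure mu); [exact/mem_set|exact/mem_set|by move=> om []].
Qed.

(** The pieces miss only a subset of [exceptional], to which the image measure
    gives no mass. *)
Lemma distribution_series E : measurable E ->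
  nu E = \sum_(0 <= k <oo) coef k * mu (E `&` piece k).
Proof.
move=> mE; pose U := \bigcup_k piece k.
have mU : measurable U.
  by apply: bigcup_measurable => k _; exact: measurable_piece.
have nuDU : nu (E `\` U) = 0.
  apply/eqP; rewrite eq_le measure_ge0 andbT.
  rewrite -(exceptional_preimage_null mu_markov mu_na g_subexp).
  have mEU := measurable_boundary_preimage g (measurableD mE mU).
  have mA := measurable_boundary_preimage g (@measurable_exceptional _ hX g).
  apply: (le_measure mu); [exact/mem_set|exact/mem_set|move=> om [_ nU]].
  by apply: contrapT => nA; apply: nU; exact: bigcup_piece.
have -> : nu E = nu (\bigcup_k (E `&` piece k)).
  by rewrite -setI_bigcupr -/U -[RHS]add0e -nuDU; exact: (measureDI nu mE mU).
apply: etrans (measure_bigcup nu _ _ _ _) _ => /=.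
- by move=> k _; apply: measurableI => //; exact: measurable_piece.
- by apply: trivIset_setIl; exact: trivIset_piece.
- rewrite [LHS](eq_eseriesl (Q := xpredT)); last by move=> k; rewrite in_setT.
  by apply: eq_eseriesr => k _; exact: distribution_piece.
Qed.

Lemma distribution_integral E : measurable E ->
  nu E = \int[mu]_(om in E) density mu g om.
Proof. by move=> mE; rewrite integral_density// distribution_series. Qed.

Lemma distribution_dominated : nu `<< mu.
Proof.
apply/null_content_dominatesP => E mE muE.
rewrite distribution_series// eseries0// => k _ _.
have mEk : measurable (E `&` piece k).
  by apply: measurableI => //; exact: measurable_piece.
suff -> : mu (E `&` piece k) = 0 by rewrite mule0.
apply/eqP; rewrite eq_le measure_ge0 andbT -muE.
by apply: le_measure; rewrite ?inE// => om [].
Qed.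

End decomposition.

Theorem theorem3p4 (X : finType) (hX : (1 < #|X|)%N) (R : realType)
    (mu : probability (infseq hX) R) (g : treeEndo X)
    (mu_markov : is_markov mu) (mu_na : non_atomic mu)
    (g_subexp : subexponential_activity R g) :
  (distribution mu (boundary g) `<< mu <->
    (forall (w : seq X) (x : X), Vmax g w ->
      mu (cylinder hX (rcons w x)) = 0 ->
      mu (boundary g @^-1` cylinder hX (rcons w x)) = 0))
  /\
  (distribution mu (boundary g) `<< mu ->
    'd (charge_of_finite_measure (distribution mu (boundary g))) '/d mu
      = density mu g %[ae mu]).
Proof.
have dom_null : distribution mu (boundary g) `<< mu ->
    forall (w : seq X) (x : X), Vmax g w ->
      mu (cylinder hX (rcons w x)) = 0 ->
      mu (boundary g @^-1` cylinder hX (rcons w x)) = 0.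
  move=> /null_content_dominatesP dom w x _.
  by apply: dom; exact: measurable_cylinder.
split; first by split=> // null_children; exact: distribution_dominated.
move=> dom; apply: integral_ae_eq => //.
- exact: Radon_Nikodym_integrable.
- exact: measurable_density.
- move=> E _ mE; rewrite -Radon_Nikodym_integral//.
  by apply: distribution_integral => //; exact: dom_null.
Qed.
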